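(* Let $d\ge3$, $D>0$. For $m<1$ let $L_m$ be the operator $L_m v=(D+|x|^2)^{(2-m)/(1-m)}\,\nabla\cdot\Big(\dfrac{\nabla v}{(D+|x|^2)^{1/(1-m)}}\Big)$ acting on the Hilbert space $L^2(\mathbb{R}^d,(D+|x|^2)^{-(2-m)/(1-m)}dx)$, and for $\alpha\in\mathbb{R}$ let $\Delta_\alpha$ be the Laplace--Beltrami operator of the Riemannian manifold $(\mathbb{R}^d,\mathbf{g}_\alpha)$ with $\mathbf{g}_\alpha(x)=(D+|x|^2)^{-\alpha}\mathbf{I}$, acting on $L^2(\mu_{\mathbf{g}_\alpha})$. Then $\Delta_\alpha$ coincides with $L_m$, both as concerns its explicit expression in Euclidean coordinates and as concerns the Hilbert space it acts on, precisely when $\alpha=1$ and $m=m_*:=(d-4)/(d-2)$.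
   Context: $\mathbf{I}$ is the Euclidean metric on $\mathbb{R}^d$, $|\cdot|$ the Euclidean norm, $\mu_{\mathbf{g}_\alpha}$ the Riemannian measure of $\mathbf{g}_\alpha$. With $V_D(x)=(D+|x|^2)^{-1/(1-m)}$, one has $L_mv=V_D^{m-2}\nabla\cdot(V_D\nabla v)$ on smooth compactly supported functions; $-L_m$ is the nonnegative self-adjoint operator associated with the closure in $L^2(\mathbb{R}^d,V_D^{2-m}dx)$ of the quadratic form $I_m[v]=\int_{\mathbb{R}^d}|\nabla v|^2V_D\,dx$, $v\in C_c^\infty(\mathbb{R}^d)$. *)

(* Defs.v *)
From HB Require Import structures.
From mathcomp Require Import all_boot all_order all_algebra.
From mathcomp Require Import all_classical all_reals all_analysis.
From mathcomp Require Import measurable_realfun.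

Set Implicit Arguments.
Unset Strict Implicit.
Unset Printing Implicit Defensive.

Import Order.TTheory GRing.Theory Num.Theory.
Import numFieldNormedType.Exports.

Local Open Scope classical_set_scope.
Local Open Scope ring_scope.

Definition measure_rV_display : measure_display. Proof. exact. Qed.

Section measurable_rV.
Context {R : realType}.
Variable n : nat.

Let coord : 'I_n -> 'rV[R]_n -> R := fun i x => x 0 i.

Let rV_set0 : g_sigma_preimage coord set0.
Proof. exact: sigma_algebra0. Qed.

Let rV_setC A : g_sigma_preimage coord A -> g_sigma_preimage coord (~` A).
Proof. exact: sigma_algebraC. Qed.

Let rV_bigcup (F : _^nat) : (forall i, g_sigma_preimage coord (F i)) ->
  g_sigma_preimage coord (\bigcup_i (F i)).
Proof. exact: sigma_algebra_bigcup. Qed.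

(* The product sigma-algebra, i.e. the Borel sigma-algebra of R^n. *)
HB.instance Definition _ := @isMeasurable.Build measure_rV_display
  'rV[R]_n (g_sigma_preimage coord) rV_set0 rV_setC rV_bigcup.

Lemma measurable_coord_rV (i : 'I_n) :
  measurable_fun [set: 'rV[R]_n] (fun x : 'rV[R]_n => x 0 i).
Proof.
move=> _ Y mY; rewrite setTI; apply: sub_sigma_algebra => /=.
rewrite -bigcup_seq/=; exists i => /=; first by rewrite mem_index_enum.
by exists Y => //; rewrite setTI.
Qed.

Lemma measurable_fun_rV d (T : measurableType d) (f : T -> 'rV[R]_n) :
  (forall i, measurable_fun [set: T] (fun t => f t 0 i)) ->
  measurable_fun [set: T] f.
Proof.
move=> mf _ Y mY; rewrite setTI.
have : g_sigma_preimage (fun i => coord i \o f) (f @^-1` Y).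
  rewrite g_sigma_preimage_comp; exists Y => //; by rewrite setTI.
apply: smallest_sub; first exact: sigma_algebra_measurable.
rewrite -bigcup_seq/=; apply: bigcup_sub => i _.
by move=> A [B mB <-]; exact: mf.
Qed.

End measurable_rV.

Section lebesgue_rV.
Context {R : realType}.
Local Open Scope ereal_scope.

Definition rV_cons n (p : R * 'rV[R]_n) : 'rV[R]_n.+1 :=
  \row_i oapp (p.2 0%R) p.1 (unlift ord0 i).

Lemma rV_cons0 n (p : R * 'rV[R]_n) : rV_cons p 0%R ord0 = p.1.
Proof. by rewrite mxE unlift_none. Qed.

Lemma rV_consS n (p : R * 'rV[R]_n) i :
  rV_cons p 0%R (lift ord0 i) = p.2 0%R i.
Proof. by rewrite mxE liftK. Qed.

Definition rV_uncons n (x : 'rV[R]_n.+1) : R * 'rV[R]_n :=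
  (x 0%R ord0, \row_i x 0%R (lift ord0 i)).

Lemma rV_consK n : cancel (@rV_cons n) (@rV_uncons n).
Proof.
case=> r x; rewrite /rV_uncons rV_cons0; congr pair.
by apply/rowP => i; rewrite mxE rV_consS.
Qed.

Lemma measurable_rV_cons n :
  measurable_fun [set: R * 'rV[R]_n] (@rV_cons n).
Proof.
apply: measurable_fun_rV => i; case: (unliftP ord0 i) => [j ->|->].
  rewrite (_ : (fun _ => _) = (fun x : 'rV[R]_n => x 0%R j) \o snd).
    by apply: measurableT_comp => //; exact: measurable_coord_rV.
  by apply/funext => p; rewrite rV_consS.
rewrite (_ : (fun _ => _) = fst) //.
by apply/funext => p; rewrite rV_cons0.
Qed.

Lemma measurable_rV_uncons n :
  measurable_fun [set: 'rV[R]_n.+1] (@rV_uncons n).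
Proof.
apply: measurable_fun_pair; first exact: measurable_coord_rV.
apply: measurable_fun_rV => i.
under eq_fun do rewrite mxE.
exact: measurable_coord_rV.
Qed.

Section lebesgue_rV_step.
Variables (n : nat) (mu : {sigma_finite_measure set 'rV[R]_n -> \bar R}).

Definition lebesgue_rV_step : set 'rV[R]_n.+1 -> \bar R :=
  pushforward (@lebesgue_measure R \x mu) (@rV_cons n).

Let preimage_cons A : measurable A -> measurable (@rV_cons n @^-1` A).
Proof. by move=> mA; rewrite -[X in measurable X]setTI; exact: measurable_rV_cons. Qed.

Let step0 : lebesgue_rV_step set0 = 0.
Proof. by rewrite /lebesgue_rV_step /pushforward preimage_set0 measure0. Qed.

Let step_ge0 A : 0 <= lebesgue_rV_step A.
Proof. rewrite /lebesgue_rV_step /pushforward; exact: measure_ge0. Qed.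

Let step_sigma_additive : semi_sigma_additive lebesgue_rV_step.
Proof.
move=> F mF tF mUF; rewrite /lebesgue_rV_step /pushforward preimage_bigcup.
apply: measure_semi_sigma_additive.
- by move=> k; exact: preimage_cons.
- apply/trivIsetP => /= i j _ _ ij; rewrite -preimage_setI.
  by move/trivIsetP : tF => /(_ _ _ _ _ ij) ->//; rewrite preimage_set0.
- by rewrite -preimage_bigcup; exact: preimage_cons.
Qed.

HB.instance Definition _ := isMeasure.Build _ _ _ lebesgue_rV_step
  step0 step_ge0 step_sigma_additive.

Let step_sigma_finite : sigma_finite setT lebesgue_rV_step.
Proof.
have /sigma_finiteP[F [TF ndF Foo]] := sigma_finiteT (@lebesgue_measure R).
have /sigma_finiteP[G [TG ndG Goo]] := sigma_finiteT mu.
exists (fun k => @rV_uncons n @^-1` (F k `*` G k)).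
  rewrite -preimage_bigcup (_ : \bigcup_k _ = setT) ?preimage_setT//.
  apply/seteqP; split => // -[r x] _.
  have [i _ Fi] : (\bigcup_k F k) r by rewrite -TF.
  have [j _ Gj] : (\bigcup_k G k) x by rewrite -TG.
  exists (maxn i j) => //; split => /=.
  - by move: r Fi; exact/subsetPset/ndF/leq_maxl.
  - by move: x Gj; exact/subsetPset/ndG/leq_maxr.
move=> k; have [mF Fk] := Foo k; have [mG Gk] := Goo k.
split.
  rewrite -[X in measurable X]setTI.
  by apply: measurable_rV_uncons => //; exact: measurableX.
rewrite /lebesgue_rV_step /pushforward -comp_preimage.
rewrite (_ : _ \o _ = id); last by apply/funext => p /=; exact: rV_consK.
rewrite preimage_id product_measure1E//.
by rewrite lte_mul_pinfty// ge0_fin_numE.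
Qed.

HB.instance Definition _ := Measure_isSigmaFinite.Build _ _ _ lebesgue_rV_step
  step_sigma_finite.

End lebesgue_rV_step.

(* R^0 is a point of mass 1; R^n.+1 carries the product of the Lebesgue
   measures of R and R^n. *)
Fixpoint lebesgue_rV n : {sigma_finite_measure set 'rV[R]_n -> \bar R} :=
  if n is n'.+1 then lebesgue_rV_step (lebesgue_rV n')
  else @dirac _ 'rV[R]_0 0%R R.

Lemma lebesgue_rV_box n (A : 'I_n -> set R) :
  (forall i, measurable (A i)) ->
  lebesgue_rV n [set x | forall i, A i (x 0%R i)] =
  \prod_(i < n) lebesgue_measure (A i).
Proof.
elim: n A => [|n IH] A mA.
  rewrite big_ord0 /= diracE mem_set//.
  by move=> [].
have mB : measurable [set x : 'rV[R]_n | forall i, A (lift ord0 i) (x 0%R i)].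
  rewrite (_ : [set x | _] = \big[setI/setT]_(i < n)
     ((fun x : 'rV[R]_n => x 0%R i) @^-1` A (lift ord0 i))).
    apply: bigsetI_measurable => i _.
    by rewrite -[X in measurable X]setTI; exact: measurable_coord_rV.
  rewrite -bigcap_seq; apply/seteqP; split => x /= h i; first by move=> _; exact: h.
  by apply: h; rewrite /= mem_index_enum.
rewrite big_ord_recl -IH// /= /lebesgue_rV_step /pushforward.
rewrite -product_measure1E//; last exact: mA.
congr (_ _); apply/seteqP; split => -[r x] /=.
  move=> h; split; first by have := h ord0; rewrite rV_cons0.
  by move=> i; have := h (lift ord0 i); rewrite rV_consS.
move=> [h0 h] i; case: (unliftP ord0 i) => [j ->|->].
  by rewrite rV_consS; exact: h.
by rewrite rV_cons0.
Qed.

End lebesgue_rV.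

Section weighted_measure.
Context d (T : measurableType d) (R : realType).
Variables (mu : {measure set T -> \bar R}) (w : T -> R).
Hypotheses (mw : measurable_fun [set: T] w) (w0 : forall x, 0 <= w x).
Local Open Scope ereal_scope.

(* The proofs that [w] is measurable and nonnegative are arguments so that the
   measure structure can be inferred. *)
Definition weighted_measure (_ : measurable_fun [set: T] w)
    (_ : forall x, (0 <= w x)%R) (A : set T) : \bar R :=
  \int[mu]_(x in A) (w x)%:E.

Local Notation nu := (weighted_measure mw w0).

Let weighted0 : nu set0 = 0.
Proof. exact: integral_set0. Qed.

Let weighted_ge0 A : 0 <= nu A.
Proof. by apply: integral_ge0 => x _; rewrite lee_fin. Qed.

Let weighted_sigma_additive : semi_sigma_additive nu.
Proof.
apply: semi_sigma_additive_nng_induced; first exact/measurable_EFinP.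
by move=> x; rewrite lee_fin.
Qed.

HB.instance Definition _ := isMeasure.Build _ _ _ nu
  weighted0 weighted_ge0 weighted_sigma_additive.

End weighted_measure.

(* [L^2(mu)] and [L^2(nu)] are the same Hilbert space: they have the same
   square-integrable functions, with the same classes modulo almost everywhere
   equality, and the same inner product. *)
Definition same_L2 d (T : measurableType d) (R : realType)
    (mu nu : {measure set T -> \bar R}) : Prop :=
  [/\ forall f : T -> R, (f \in Lfun mu 2%:E) = (f \in Lfun nu 2%:E),
      forall f g : T -> R, f \in Lfun mu 2%:E -> g \in Lfun mu 2%:E ->
        ae_eq mu setT f g <-> ae_eq nu setT f g &
      forall f g : T -> R, f \in Lfun mu 2%:E -> g \in Lfun mu 2%:E ->
        Rintegral mu setT (fun x => f x * g x) =
        Rintegral nu setT (fun x => f x * g x)].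

Section calculus.
Context {R : realType} {d : nat}.
Implicit Types (v : 'rV[R]_d -> R) (X : 'rV[R]_d -> 'rV[R]_d) (x : 'rV[R]_d).

(* The norm of the library on 'rV[R]_d is the sup norm. *)
Definition enorm x : R := Num.sqrt (\sum_i x 0 i ^+ 2).

Definition partial (i : 'I_d) v : 'rV[R]_d -> R :=
  fun x => 'D_(delta_mx 0 i) v x.

Definition grad v : 'rV[R]_d -> 'rV[R]_d := fun x => \row_i partial i v x.

Definition divergence X : 'rV[R]_d -> R :=
  fun x => \sum_i partial i (fun y => X y 0 i) x.

Definition iter_partial (s : seq 'I_d) v := foldr partial v s.

(* C^infinity: the partial derivatives of all orders exist and are continuous. *)
Definition smooth v : Prop := forall s : seq 'I_d,
  continuous (iter_partial s v) /\
  forall i x, derivable (iter_partial s v) x (delta_mx 0 i).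

Definition test_function v : Prop :=
  smooth v /\ compact (closure [set x | v x != 0]).

Definition same_expression (L1 L2 : ('rV[R]_d -> R) -> 'rV[R]_d -> R) : Prop :=
  forall v, test_function v -> forall x, L1 v x = L2 v x.

End calculus.

(* A Riemannian metric on R^d is given by its matrix in Euclidean coordinates. *)

Section riemannian.
Context {R : realType} {d : nat}.
Variable g : 'rV[R]_d -> 'M[R]_d.

Definition volume_density : 'rV[R]_d -> R := fun x => Num.sqrt (\det (g x)).

Lemma volume_density_ge0 x : 0 <= volume_density x.
Proof. exact: sqrtr_ge0. Qed.

Definition riemannian_measure (mg : measurable_fun setT volume_density) :
    {measure set 'rV[R]_d -> \bar R} :=
  weighted_measure (lebesgue_rV d) mg volume_density_ge0.

(* The matrix of [g] is symmetric, so that [w *m invmx g] is the row vector of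
   the [g^{ij} w_j]. *)
Definition riemannian_grad (v : 'rV[R]_d -> R) : 'rV[R]_d -> 'rV[R]_d :=
  fun x => grad v x *m invmx (g x).

Definition riemannian_div (X : 'rV[R]_d -> 'rV[R]_d) : 'rV[R]_d -> R :=
  fun x => (volume_density x)^-1 *
    divergence (fun y => volume_density y *: X y) x.

Definition laplace_beltrami (v : 'rV[R]_d -> R) : 'rV[R]_d -> R :=
  riemannian_div (riemannian_grad v).

End riemannian.

Section operators.
Context {R : realType} (d : nat) (D : R).

Lemma measurable_powR_enorm (p : R) :
  measurable_fun setT (fun x : 'rV[R]_d => (D + enorm x ^+ 2) `^ p).
Proof.
have mq : measurable_fun setT (fun x : 'rV[R]_d => D + enorm x ^+ 2).
  rewrite (_ : (fun _ => _) = fun x : 'rV[R]_d => D + \sum_i x 0 i ^+ 2).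
    apply: measurable_funD => //; apply: measurable_sum => i.
    by apply: measurable_funX; exact: measurable_coord_rV.
  apply/funext => x; rewrite sqr_sqrtr//.
  by apply: sumr_ge0 => i _; exact: sqr_ge0.
exact: (measurableT_comp (measurable_powR p) mq).
Qed.

Definition metric_alpha (alpha : R) : 'rV[R]_d -> 'M[R]_d :=
  fun x => ((D + enorm x ^+ 2) `^ (- alpha)) *: 1%:M.

Lemma measurable_volume_density_alpha (alpha : R) :
  measurable_fun setT (volume_density (metric_alpha alpha)).
Proof.
rewrite (_ : volume_density _ =
    fun x => (((D + enorm x ^+ 2) `^ (- alpha)) ^+ d) `^ 2^-1).
  apply: (measurableT_comp (measurable_powR _)).
  by apply: measurable_funX; exact: measurable_powR_enorm.
apply/funext => x; rewrite powR12_sqrt ?exprn_ge0 ?powR_ge0//.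
by rewrite /volume_density /metric_alpha scalemx1 det_scalar.
Qed.

Definition mu_alpha (alpha : R) : {measure set 'rV[R]_d -> \bar R} :=
  riemannian_measure (measurable_volume_density_alpha alpha).

Definition Delta_alpha (alpha : R) :
    ('rV[R]_d -> R) -> 'rV[R]_d -> R :=
  laplace_beltrami (metric_alpha alpha).

Definition mu_L (m : R) : {measure set 'rV[R]_d -> \bar R} :=
  weighted_measure (lebesgue_rV d)
    (measurable_powR_enorm (- ((2 - m) / (1 - m))))
    (fun x => powR_ge0 (D + enorm x ^+ 2) (- ((2 - m) / (1 - m)))).

Definition L_op (m : R) (v : 'rV[R]_d -> R) : 'rV[R]_d -> R :=
  fun x => (D + enorm x ^+ 2) `^ ((2 - m) / (1 - m)) *
    divergence
      (fun y => ((D + enorm y ^+ 2) `^ (1 / (1 - m)))^-1 *: grad v y) x.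

Definition m_star : R := (d%:R - 4) / (d%:R - 2).

End operators.

(* Main.v *)
Require Import Defs.
From mathcomp Require Import all_boot all_order all_algebra.
From mathcomp Require Import all_classical all_reals all_analysis.
From mathcomp Require Import ring lra.
Import Order.TTheory GRing.Theory Num.Theory.
Import numFieldNormedType.Exports.
Local Open Scope classical_set_scope.
Local Open Scope ring_scope.

(** On smooth functions both operators have the form
    [v |-> h^s div (h^q grad v)] with [h = D + |x|^2], which expands to
    [h^(s+q) (Laplacian v) + 2 q h^(s+q-1) (x . grad v)]. Evaluated at the centre
    of a radial bump function (zero gradient, nonzero Laplacian) where [h <> 1],
    equality of the operators forces [h^alpha = h], hence [alpha = 1]; evaluated
    off the centre of a bump function centred at the origin
    (where [x . grad v <> 0]), it then forces [1 - d/2 = -1/(1-m)].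
    Conversely, for these values of [alpha] and [m] the coefficients and the
    densities of the two measures agree pointwise. *)

(** * One-variable functions that vanish to infinite order at 0 *)

Section flat.
Context {R : realType}.
Implicit Types (n : nat) (t : R).

(** [flat 0] is the classical smooth function [exp(-1/t)] cut off at 0. The power of [1/t] makes the
    family stable under differentiation up to linear combinations. *)
Definition flat n t : R := if 0 < t then t^-1 ^+ n * expR (- t^-1) else 0.

Lemma flat_gt0 n t : 0 < t -> 0 < flat n t.
Proof.
by move=> t0; rewrite /flat t0 mulr_gt0 ?expR_gt0// exprn_gt0// invr_gt0.
Qed.

(** The term of degree [n.+2] in the series of [expR t^-1] bounds it from below. This linear bound
    gives the limit at 0 needed for differentiability there. *)
Lemma flat_le_linear n t : `|flat n.+1 t| <= n.+2`!%:R * `|t|.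
Proof.
rewrite /flat; case: ifPn => t0; last by rewrite normr0 mulr_ge0.
have e0 := expR_gt0 t^-1; have ti0 : 0 < t^-1 by rewrite invr_gt0.
have f0 : 0 < n.+2`!%:R :> R by rewrite ltr0n fact_gt0.
rewrite !gtr0_norm ?mulr_gt0 ?exprn_gt0 ?expR_gt0//.
have : t^-1 ^+ n.+2 / n.+2`!%:R <= expR t^-1.
  by apply: le_trans (expR_ge1Dxn n.+1 (ltW ti0)); rewrite lerDr.
rewrite ler_pdivrMr// exprS mulrC ler_pdivrMr// => H.
by rewrite expRN ler_pdivrMr// mulrAC [_%:R * _]mulrC.
Qed.

Lemma is_derive_flat n t :
  is_derive t 1 (flat n) (flat n.+2 t - n%:R * flat n.+1 t).
Proof.
have [t0|t0|->] := ltgtP t 0.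
- rewrite /flat ltNge (ltW t0)/= mulr0 subr0.
  apply: (@near_eq_is_derive _ _ _ (cst 0)).
  near=> z.
  have : z < 0 by near: z; exact: lt_nbhsl.
  by rewrite ltNge le_eqVlt negb_or => /andP[_ /negbTE ->].
- apply: (@near_eq_is_derive _ _ _ (GRing.inv ^+ n * (expR \o (fun z => - z^-1)))).
    near=> z.
    have z0 : 0 < z by near: z; exact: lt_nbhsr.
    by rewrite /flat z0/= fctE exprfctE.
  have tn0 : t != 0 by rewrite gt_eqF.
  have dV : is_derive t 1 (@GRing.inv R) (- t ^- 2).
    have := is_deriveV tn0 (is_derive_id t (1 : R)).
    by rewrite /GRing.scale/= mulr1.
  have dE : is_derive t 1 (expR \o (fun z => - z^-1)) (t ^- 2 * expR (- t^-1)).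
    apply: (@is_derive_eq _ _ _ _ _ _ _ _
      (is_derive1_comp (is_derive_expR _) (is_deriveN dV))).
    by rewrite opprK mulrC.
  apply: is_derive_eq.
  rewrite /flat t0 /= exprfctE -exprVn /GRing.scale/=.
  case: n => [|n] /=; first by ring.
  by rewrite !exprS; ring.
- rewrite /flat ltxx mulr0 subr0 -/(flat n).
  suff H : (fun h : R =>
      h^-1 *: ((flat n \o shift 0) (h *: 1) - flat n 0)) @ 0^' --> 0.
    by apply: DeriveDef; [apply: cvgP H | exact: cvg_lim H].
  (* The difference quotient of [flat n] at 0 is exactly [flat n.+1], which tends to 0 by the linear
     bound. *)
  have -> : (fun h : R =>
      h^-1 *: ((flat n \o shift 0) (h *: 1) - flat n 0)) =
      flat n.+1.
    apply/funext => h /=; rewrite addr0 [h *: 1]mulr1 /flat ltxx subr0.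
    case: ifP => _; last by rewrite scaler0.
    by rewrite exprS -mulrA.
  apply: norm_cvg0; apply: (@squeeze_cvgr _ _ _ _ (cst 0)
    (fun t => n.+2`!%:R * `|t|)).
  + by near=> z; rewrite normr_ge0 flat_le_linear.
  + exact: cvg_cst.
  + rewrite -[X in _ --> X](mulr0 n.+2`!%:R).
    apply: cvgM; first exact: cvg_cst.
    apply: cvg_within_filter.
    by have := @norm_continuous R R 0; rewrite /continuous_at normr0.
Unshelve. all: by end_near.
Qed.

End flat.

(** * Chain rule for directional derivatives *)

Section directional.
Context {R : realType} {V : normedModType R}.

Lemma is_derive_comp (f : R -> R) (w : V -> R) (x v : V) (df : R) :
  differentiable w x -> is_derive (w x) 1 f df ->
  is_derive x v (fun y => f (w y)) (df * 'D_v w x).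
Proof.
move=> dw [/derivable1_diffP dff <-].
have dfw : differentiable (f \o w) x by exact: differentiable_comp.
apply: DeriveDef; first exact: diff_derivable.
rewrite [LHS](deriveE v dfw) diff_comp//= deriveE//.
by rewrite diff1E// derive1E -(deriveE v dw) scale1r mulrC.
Qed.

End directional.

(** * A stock of smooth functions on [R^d] *)

Section elementary.
Context {R : realType} {d : nat}.
Implicit Types (u w : 'rV[R]_d -> R) (x a : 'rV[R]_d) (i : 'I_d).

(* A class of differentiable functions closed under partial derivatives, whose
   members are therefore smooth. *)
Inductive elementary : ('rV[R]_d -> R) -> Prop :=
| elementary_cst c : elementary (fun=> c)
| elementary_coord i : elementary (fun x => x 0 i)
| elementaryD u w : elementary u -> elementary w ->
    elementary (fun x => u x + w x)
| elementaryM u w : elementary u -> elementary w ->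
    elementary (fun x => u x * w x)
| elementary_flat n u : elementary u -> elementary (fun x => flat n (u x)).

Lemma elementary_sum (I : Type) (s : seq I) (u : I -> 'rV[R]_d -> R) :
  (forall j, elementary (u j)) -> elementary (fun x => \sum_(j <- s) u j x).
Proof.
move=> eu; elim: s => [|j s IH].
  under eq_fun do rewrite big_nil; exact: elementary_cst.
under eq_fun do rewrite big_cons; exact: elementaryD.
Qed.

Lemma elementary_differentiable u x : elementary u -> differentiable u x.
Proof.
elim=> {u} [c|i|u w _ du _ dw|u w _ du _ dw|n u _ du].
- exact: differentiable_cst.
- exact: differentiable_coord.
- exact: differentiableD.
- exact: differentiableM.
- apply: (@differentiable_comp _ _ _ _ u (flat n)) => //.
  by apply/derivable1_diffP; apply: ex_derive; exact: is_derive_flat.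
Qed.

Lemma derive_coord i j x :
  'D_(delta_mx 0 i) (fun y : 'rV[R]_d => y 0 j) x = (i == j)%:R :> R.
Proof.
apply: cvg_lim => //; apply: cvg_near_cst; near=> h.
have h0 : h != 0 by near: h; exact: nbhs_dnbhs_neq.
rewrite /= !mxE addrK eqxx/= eq_sym scalerA mulVf// scale1r//.
Unshelve. all: by end_near.
Qed.

(** By induction on [u]. In the last case the chain rule produces [flat n.+1] and [flat n.+2], which
    is why the class contains [flat n] for every [n]. *)
Lemma elementary_partial i u : elementary u -> elementary (partial i u).
Proof.
elim=> {u} [c|j|u w eu du ew dw|u w eu du ew dw|n u eu du].
- rewrite (_ : partial i _ = fun=> 0); first exact: elementary_cst.
  by apply/funext => x; exact: derive_cst.
- rewrite (_ : partial i _ = fun=> (i == j)%:R); first exact: elementary_cst.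
  by apply/funext => x; exact: derive_coord.
- rewrite (_ : partial i _ = fun x => partial i u x + partial i w x).
    exact: elementaryD.
  by apply/funext => x; apply: deriveD; apply: diff_derivable;
    exact: elementary_differentiable.
- rewrite (_ : partial i _ =
      fun x => u x * partial i w x + w x * partial i u x).
    by apply: elementaryD; exact: elementaryM.
  by apply/funext => x; apply: deriveM; apply: diff_derivable;
    exact: elementary_differentiable.
- rewrite (_ : partial i _ =
      fun x => (flat n.+2 (u x) + - n%:R * flat n.+1 (u x)) * partial i u x).
    apply: elementaryM => //; apply: elementaryD; first exact: elementary_flat.
    apply: elementaryM; [exact: elementary_cst|exact: elementary_flat].
  apply/funext => x; apply: derive_val.
  rewrite mulNr; apply: is_derive_comp; last exact: is_derive_flat.
  exact: elementary_differentiable.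
Qed.

Lemma elementary_smooth u : elementary u -> smooth u.
Proof.
move=> eu s; have es : elementary (iter_partial s u).
  by elim: s => //= i s; exact: elementary_partial.
by split=> [x|i x]; [apply: differentiable_continuous|apply: diff_derivable];
  exact: elementary_differentiable.
Qed.

End elementary.

(** * Radial bump functions and their derivatives *)

Section bump.
Context {R : realType} {d : nat}.
Implicit Types (x a : 'rV[R]_d) (i : 'I_d).

(** Free of the square root in [enorm], hence visibly a polynomial in the coordinates. *)
Definition sqdist a x : R := \sum_i (x 0 i - a 0 i) ^+ 2.

Lemma enorm_sqdist x : enorm x ^+ 2 = sqdist 0 x.
Proof.
rewrite sqr_sqrtr; last by apply: sumr_ge0 => i _; exact: sqr_ge0.
by apply: eq_bigr => i _; rewrite mxE subr0.
Qed.

Lemma sqdistxx a : sqdist a a = 0.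
Proof. by apply: big1 => i _; rewrite subrr expr0n. Qed.

Lemma sqdist0_scale_delta (t : R) i : sqdist 0 (t *: delta_mx 0 i) = t ^+ 2.
Proof.
rewrite /sqdist (bigD1 i)//= !mxE !eqxx mulr1 subr0 big1 ?addr0// => j ji.
by rewrite !mxE eqxx (negbTE ji) mulr0 subr0 expr0n.
Qed.

Lemma elementary_shift i a : elementary (fun x => x 0 i - a 0 i).
Proof. apply: elementaryD; [exact: elementary_coord|exact: elementary_cst]. Qed.

Lemma elementary_sqdist a : elementary (sqdist a).
Proof.
by apply: elementary_sum => i; apply: elementaryM; exact: elementary_shift.
Qed.

Lemma is_derive_shift_coord i j a x :
  is_derive x (delta_mx 0 i) (fun y => y 0 j - a 0 j) (i == j)%:R.
Proof.
apply: DeriveDef.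
  exact/diff_derivable/elementary_differentiable/elementary_shift.
rewrite deriveB ?derive_coord ?derive_cst ?subr0//.
exact/diff_derivable/differentiable_coord.
Qed.

Lemma partial_sqdist i a x : partial i (sqdist a) x = 2 * (x 0 i - a 0 i).
Proof.
have H j := is_deriveX 2 (is_derive_shift_coord i j a x).
have -> : sqdist a = \sum_j (fun y : 'rV[R]_d => y 0 j - a 0 j) ^+ 2.
  by apply/funext => y; rewrite fct_sumE.
rewrite [LHS](@derive_val _ _ _ _ _ _ _ (is_derive_sum H)).
rewrite (bigD1 i)//= big1 ?addr0 => [|j ji].
  by rewrite eqxx [_ *: _]mulr1.
by rewrite eq_sym (negbTE ji) scaler0.
Qed.

(** Positive exactly on the open Euclidean unit ball centred at [a]. *)
Definition bump a x : R := flat 0 (1 - sqdist a x).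

Lemma elementary_one_sub_sqdist a : elementary (fun x => 1 - sqdist a x).
Proof.
under eq_fun do rewrite -mulN1r.
apply: elementaryD; first exact: elementary_cst.
by apply: elementaryM; [exact: elementary_cst|exact: elementary_sqdist].
Qed.

(** For [n = 0] only [flat 2] survives in the derivative of [flat n]. The factor [x 0 i - a 0 i]
    makes the gradient vanish at the centre. *)
Lemma partial_bump i a :
  partial i (bump a) =
  fun x => - 2 * flat 2 (1 - sqdist a x) * (x 0 i - a 0 i).
Proof.
apply/funext => x; rewrite /partial /bump.
have dw := elementary_differentiable _ x (elementary_one_sub_sqdist a).
rewrite (@derive_val _ _ _ _ _ _ _
  (is_derive_comp _ _ _ (delta_mx 0 i) _ dw (is_derive_flat 0 _))).
rewrite mul0r subr0 deriveB ?derive_cst//; last first.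
  exact/diff_derivable/elementary_differentiable/elementary_sqdist.
by rewrite [X in 0 - X]partial_sqdist; ring.
Qed.

(** In the product rule the factor [y 0 i - a 0 i] vanishes at [a], so each coordinate contributes
    only [-2 * flat 2 1]. *)
Lemma laplacian_bump a :
  divergence (grad (bump a)) a = - (2 * d%:R) * flat 2 1.
Proof.
rewrite /divergence (eq_bigr (fun=> -2 * flat 2 1 : R)); last first.
  move=> i _.
  have -> : (fun y => grad (bump a) y 0 i) =
      (fun y => - 2 * flat 2 (1 - sqdist a y)) * (fun y => y 0 i - a 0 i).
    by apply/funext => y; rewrite mxE partial_bump.
  rewrite /partial deriveM.
  - rewrite (@derive_val _ _ _ _ _ _ _ (is_derive_shift_coord i i a a)).
    by rewrite eqxx subrr scale0r addr0 sqdistxx subr0 [_ *: _]mulr1.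
  - apply/diff_derivable/elementary_differentiable/elementaryM.
      exact: elementary_cst.
    exact/elementary_flat/elementary_one_sub_sqdist.
  - exact: (@ex_derive _ _ _ _ _ _ _ (is_derive_shift_coord i i a a)).
by rewrite sumr_const card_ord -mulr_natl; ring.
Qed.

Lemma test_function_bump a : test_function (bump a).
Proof.
split; first exact/elementary_smooth/elementary_flat/elementary_one_sub_sqdist.
(* The cube of side 2 around [a] contains the unit ball and is compact as a product of segments. *)
pose B := [set x : 'rV[R]_d | forall i, `[a 0 i - 1, a 0 i + 1]%classic (x ord0 i)].
have cB : compact B.
  apply: (@rV_compact _ _ (fun i => `[a 0 i - 1, a 0 i + 1]%classic)) => i.
  exact: segment_compact.
apply: (subclosed_compact (@closed_closure _ _) cB).
have /closure_id -> : closed B.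
  by apply: compact_closed => //; exact: norm_hausdorff.
apply: closure_subset => x; rewrite /= /bump /flat.
case: ifPn => [|_ /eqP//]; rewrite subr_gt0 => xa _ i /=.
have : (x 0 i - a 0 i) ^+ 2 < 1.
  apply: le_lt_trans xa; rewrite /sqdist (bigD1 i)//= lerDl.
  by apply: sumr_ge0 => j _; exact: sqr_ge0.
by rewrite in_itv/=; nra.
Qed.

End bump.

(** * Weighted divergence-form operators, with [Delta_alpha] and [L_op] as instances *)

Section weighted_operator.
Context {R : realType} {d : nat} (D : R) (hD : 0 < D).
Implicit Types (x : 'rV[R]_d) (i : 'I_d) (v : 'rV[R]_d -> R) (s q : R).

Local Notation h x := (D + enorm x ^+ 2).

Definition weighted_operator s q v x : R :=
  h x `^ s * divergence (fun y => h y `^ q *: grad v y) x.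

Lemma weight_gt0 x : 0 < h x.
Proof. by rewrite ltr_wpDr// sqr_ge0. Qed.

Lemma is_derive_weight q i x :
  is_derive x (delta_mx 0 i) (fun y => h y `^ q)
    (2 * q * h x `^ (q - 1) * x 0 i).
Proof.
have eh : elementary (fun y : 'rV[R]_d => h y).
  under eq_fun do rewrite enorm_sqdist.
  by apply: elementaryD; [exact: elementary_cst|exact: elementary_sqdist].
have dh := elementary_differentiable _ x eh.
have := is_derive_comp _ _ _ (delta_mx 0 i) _ dh (is_derive1_powR q (weight_gt0 x)).
suff -> : 'D_(delta_mx 0 i) (fun y : 'rV[R]_d => h y) x = 2 * x 0 i.
  by congr is_derive; ring.
rewrite deriveD ?derive_cst ?add0r.
- rewrite (_ : (fun y => _) = sqdist 0); last first.
    by apply/funext => y; exact: enorm_sqdist.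
  by rewrite [LHS]partial_sqdist mxE subr0.
- exact/diff_derivable/differentiable_cst.
- rewrite (_ : (fun y => _) = sqdist 0); last first.
    by apply/funext => y; exact: enorm_sqdist.
  exact/diff_derivable/elementary_differentiable/elementary_sqdist.
Qed.

(** Leibniz's rule is applied to each product of [h^q] with a partial derivative of [v]; positivity
    of [h] allows the powers to be merged. *)
Lemma weighted_operatorE s q v x : smooth v ->
  weighted_operator s q v x =
  h x `^ (s + q) * divergence (grad v) x +
  2 * q * h x `^ (s + q - 1) * \sum_i x 0 i * partial i v x.
Proof.
move=> sv; have hx : h x != 0 by rewrite gt_eqF// weight_gt0.
have powRD_weight r t : h x `^ (r + t) = h x `^ r * h x `^ t.
  by rewrite powRD// hx implybT.
rewrite [RHS](_ : _ = h x `^ s * (h x `^ q * divergence (grad v) x +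
    2 * q * h x `^ (q - 1) * \sum_i x 0 i * partial i v x)); last first.
  by rewrite !powRD_weight; ring.
congr (_ * _).
rewrite /divergence 2!mulr_sumr -big_split/=; apply: eq_bigr => i _.
have -> : (fun y => (h y `^ q *: grad v y) 0 i) =
    (fun y : 'rV[R]_d => h y `^ q) * partial i v.
  by apply/funext => y; rewrite !mxE.
have -> : (fun y => grad v y 0 i) = partial i v.
  by apply/funext => y; rewrite !mxE.
have dv : derivable (partial i v) x (delta_mx 0 i) by exact: (sv [:: i]).2.
have dw := is_derive_weight q i x.
rewrite [LHS]deriveM//.
rewrite (@derive_val _ _ _ _ _ _ _ dw) -/(partial i (partial i v) x).
by rewrite /GRing.scale/=; ring.
Qed.

Lemma volume_density_metric_alpha (alpha : R) x :
  volume_density (metric_alpha D alpha) x = h x `^ (- (alpha * d%:R / 2)).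
Proof.
rewrite /volume_density /metric_alpha scalemx1 det_scalar.
rewrite -powR12_sqrt ?exprn_ge0 ?powR_ge0// -(@powR_mulrn _ _ d) ?powR_ge0//.
by rewrite -!powRrM mulNr mulrA.
Qed.

(** The inverse metric contributes [h^alpha] and the volume density [h^(-alpha d/2)]. *)
Lemma Delta_alphaE (alpha : R) v x :
  Delta_alpha D alpha v x =
  weighted_operator (alpha * d%:R / 2) (alpha - alpha * d%:R / 2) v x.
Proof.
rewrite /Delta_alpha /laplace_beltrami /riemannian_div /weighted_operator.
rewrite volume_density_metric_alpha powRN invrK; congr (_ * divergence _ x).
apply/funext => y; rewrite volume_density_metric_alpha /riemannian_grad.
have hy : h y != 0 by rewrite gt_eqF// weight_gt0.
rewrite /metric_alpha scalemx1 invmx_scalar mul_mx_scalar scalerA.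
by rewrite -powRN opprK -powRD ?hy ?implybT// [- _ + _]addrC.
Qed.

Lemma L_opE (m : R) v x :
  L_op D m v x = weighted_operator ((2 - m) / (1 - m)) (- (1 / (1 - m))) v x.
Proof.
rewrite /L_op /weighted_operator; congr (_ * divergence _ x).
by apply/funext => y; rewrite powRN.
Qed.

End weighted_operator.

(** * Comparison of the operators and of the measures *)

Theorem lemma4p1 (R : realType) (d : nat) (D m alpha : R)
    (hd : (3 <= d)%N) (hD : 0 < D) (hm : m < 1) :
  same_expression (@Delta_alpha R d D alpha) (@L_op R d D m) /\
  same_L2 (@mu_alpha R d D alpha) (@mu_L R d D m)
  <->
  alpha = 1 /\ m = @m_star R d.
Proof.
have d3 : 3 <= d%:R :> R by rewrite ler_nat.
have d2 : d%:R - 2 != 0 :> R by rewrite gt_eqF//; lra.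
have m1 : 1 - m != 0 by rewrite gt_eqF// subr_gt0.
split=> [[same _]|[-> mE]]; last first.
  (* At [m_star] this value of [1 - m] turns the exponents of [L_op] into [d/2] and [1 - d/2], those
     of [Delta_alpha] for [alpha = 1]. *)
  have E : 1 - m = 2 / (d%:R - 2) by rewrite mE /m_star; field.
  have e1 : (2 - m) / (1 - m) = 1 * d%:R / 2.
    have -> : 2 - m = 1 + (1 - m) by ring.
    by rewrite E; field.
  have e2 : 1 - 1 * d%:R / 2 = - (1 / (1 - m)) by rewrite E; field.
  split=> [v _ x|]; first by rewrite Delta_alphaE// L_opE e1 e2.
  (* Once the measures are equal, [same_L2] is reflexivity. *)
  suff -> : mu_alpha d D 1 = mu_L d D m by split.
  apply: eq_measure; apply/funext => A.
  apply: eq_integral => x _.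
  by rewrite volume_density_metric_alpha// e1.
pose i0 : 'I_d := Ordinal (ltn_trans (isT : 0 < 2)%N hd).
(* The two expanded operators on [bump a]: the exponents [s + q] are [alpha] for [Delta_alpha] and 1
   for [L_op]. *)
have key (a x : 'rV[R]_d) (w := D + enorm x ^+ 2)
    (S := \sum_i x 0 i * partial i (bump a) x) :
  w `^ alpha * divergence (grad (bump a)) x +
    2 * (alpha - alpha * d%:R / 2) * w `^ (alpha - 1) * S =
  w `^ 1 * divergence (grad (bump a)) x +
    2 * - (1 / (1 - m)) * w `^ (1 - 1) * S.
  have := same _ (test_function_bump a) x.
  have smooth_bump := (test_function_bump a).1.
  rewrite Delta_alphaE// L_opE !weighted_operatorE// (addrC (alpha * _ / _)) subrK.
  by rewrite (_ : (2 - m) / (1 - m) - 1 / (1 - m) = 1); last by field.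
have alpha1 : alpha = 1.
  (* At a unit vector the weight is [D + 1 > 1], so its logarithm is nonzero and its powers
     determine the exponent; at the origin the weight [D] could be 1. *)
  pose a : 'rV[R]_d := 1 *: delta_mx 0 i0.
  have := key a a; cbv zeta.
  rewrite [\sum_i _]big1; last first.
    by move=> i _; rewrite partial_bump subrr !mulr0.
  rewrite !mulr0 !addr0 laplacian_bump.
  move/mulIf => H.
  have {H} : (D + enorm a ^+ 2) `^ alpha = (D + enorm a ^+ 2) `^ 1.
    apply: H; rewrite mulf_neq0// ?oppr_eq0 ?gt_eqF ?flat_gt0//.
    by rewrite mulr_gt0// (lt_le_trans _ d3).
  rewrite enorm_sqdist sqdist0_scale_delta expr1n => /(congr1 (@ln R)).
  rewrite !ln_powR => /mulIf; apply.
  by rewrite ln_eq0; lra.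
split=> //; move: key; rewrite alpha1 => key.
(* This point lies inside the unit ball but off its centre, so [flat 2 (1 - 1/4)] and
   [x . grad (bump 0)] are nonzero. With [alpha = 1] the Laplacian terms cancel and the remaining
   weights are [h^0 = 1]. *)
pose x : 'rV[R]_d := 2^-1 *: delta_mx 0 i0.
have := key 0 x; cbv zeta; move/addrI.
rewrite subrr powRr0 !mulr1.
have S0 : \sum_i x 0 i * partial i (bump 0) x != 0.
  have -> : \sum_i x 0 i * partial i (bump 0) x =
      - 2 * flat 2 (1 - sqdist 0 x) * sqdist 0 x.
    rewrite {2}/sqdist mulr_sumr; apply: eq_bigr => i _.
    have x0 : x 0 i - (0 : 'rV[R]_d) 0 i = x 0 i.
      by rewrite [X in _ - X]mxE subr0.
    by rewrite partial_bump x0; ring.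
  rewrite sqdist0_scale_delta !mulf_neq0 ?oppr_eq0 ?expf_neq0 ?invr_eq0//.
  by rewrite gt_eqF// flat_gt0//; lra.
move=> /(mulIf S0) H.
(* Clearing denominators in [1 - d/2 = -1/(1-m)] leaves an equation linear in [m]. *)
have {}H : (d%:R - 2) * (1 - m) = 2.
  have : (1 - d%:R / 2) * (1 - m) = - 1.
    have -> : 1 - d%:R / 2 = - (1 / (1 - m)) by lra.
    by field.
  lra.
rewrite /m_star.
apply: (mulIf d2); rewrite divfK//; lra.
Qed.
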